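(* Let $j$, $r$, $m_0$ be positive integers with $j<r$. Suppose that $(r-1)(m-1)+1\leq g(m,j)< r(m-1)$ for every integer $m\geq m_0$ (with $m\ge 2$). Then $$(3r-j-1)(m-1)+1 < g(m,r)\leq (3r-j)(m-1)$$ for every integer $m\geq m_0$ (with $m\geq 2$).
   Context: For positive integers $m$ and $r$, $g(m,r)$ denotes the least positive integer $N$ such that for every map $\Delta:\{1,2,\ldots,N\}\to\{1,2,\ldots,r\}$ there exist $2m$ integers $x_1<\cdots<x_m<y_1<\cdots<y_m$ in $\{1,\ldots,N\}$ with $\Delta(x_1)=\cdots=\Delta(x_m)$, $\Delta(y_1)=\cdots=\Delta(y_m)$, and $2(x_m-x_1)\leq y_m-x_1$. *)

(* Defs.v *)
From mathcomp Require Import all_boot zify.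
From mathcomp Require Import boolp.

Set Implicit Arguments.
Unset Strict Implicit.
Unset Printing Implicit Defensive.

(* A colouring of {1, ..., N} with r colours is given by D : nat -> 'I_r, of
   which only the values on {1, ..., N} matter.  The sequences x and y hold
   x_1 < ... < x_m and y_1 < ... < y_m; for m > 0 the subtractions are not
   truncated, because x ++ y is increasing. *)
Definition unavoidable (m r N : nat) : Prop :=
  forall D : nat -> 'I_r, exists x y : seq nat,
    [/\ size x = m /\ size y = m,
        sorted ltn (x ++ y),
        all (fun i => 1 <= i <= N) (x ++ y),
        constant (map D x) /\ constant (map D y)
      & 2 * (last 0 x - head 0 x) <= last 0 y - head 0 x].

Lemma mono_block (r m a : nat) (D : nat -> 'I_r) :
  exists s : seq nat,
    [/\ size s = m, sorted ltn s,
        all (fun i => a <= i < a + (r * m.-1).+1) s & constant (map D s)].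
Proof.
pose K := (r * m.-1).+1.
pose cls c := [seq i <- iota a K | D i == c].
have [c hc] : exists c, m <= size (cls c).
  case: (boolP [exists c, m <= size (cls c)]) => [/existsP //|].
  rewrite negb_exists => /forallP hlt; exfalso; move: (ltnn K) => /negP; apply.
  have hle : \sum_(c < r) size (cls c) <= r * m.-1.
    rewrite -[X in X * _]card_ord -sum_nat_const; apply: leq_sum => c _.
    by have := hlt c; rewrite -ltnNge; lia.
  suff hK : \sum_(c < r) size (cls c) = K by rewrite -{1}hK /K ltnS.
  under eq_bigr => c _ do rewrite size_filter -sum1_count.
  rewrite (exchange_big_dep xpredT) //=.
  under eq_bigr => i _ do rewrite (big_pred1 (D i)) //.
  by rewrite sum1_size /= size_iota.
have hsub : subseq (take m (cls c)) (iota a K).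
  by apply: (subseq_trans (take_subseq _ _)); apply: filter_subseq.
exists (take m (cls c)); split.
- by rewrite size_takel.
- exact: (subseq_sorted ltn_trans hsub (iota_ltn_sorted _ _)).
- by apply/allP => i /(mem_subseq hsub); rewrite mem_iota.
- apply/(@constantP _ c); exists c.
  apply/all_pred1P/allP => _ /mapP[i /mem_take + ->].
  by rewrite mem_filter => /andP[].
Qed.

Lemma unavoidable_exists (m r : nat) :
  exists N, `[< 0 < N /\ unavoidable m r N >].
Proof.
pose K := (r * m.-1).+1.
have K0 : 0 < K by [].
exists (4 * K); apply/asboolP; split=> // D.
have [x [sx ox ax cx]] := mono_block m 1 D.
have [y [sy oy ay cy]] := mono_block m (1 + 3 * K) D.
rewrite -/K in ax ay; move: K K0 ax ay => K K0 ax ay.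
exists x, y; split=> //.
- case: x y sx ox ax sy oy ay {cx cy} => [|x0 x] [|y0 y] //= sx ox ax sy oy ay;
    do ?by rewrite ?cats0.
  rewrite cat_path ox /= oy andbT.
  have := allP (ax : all _ (x0 :: x)) _ (mem_last x0 x).
  by move: ay => /andP[+ _] /=; lia.
- rewrite all_cat; apply/andP; split.
    by apply: sub_all ax => i; lia.
  by apply: sub_all ay => i; lia.
- case: x y sx ax sy ay {ox oy cx cy} => [|x0 x] [|y0 y] //= sx ax sy ay;
    try by move: sx sy; lia.
  have := allP (ax : all _ (x0 :: x)) _ (mem_last x0 x).
  have := allP (ay : all _ (y0 :: y)) _ (mem_last y0 y).
  by move: ax => /andP[+ _] /=; lia.
Qed.

Definition g (m r : nat) : nat := ex_minn (unavoidable_exists m r).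

(* Main.v *)
Require Import Defs.
From mathcomp Require Import all_boot.
From mathcomp Require Import zify boolp.

(* Write M = m - 1.

   Upper bound: some colour occurs more than M times in the first rM + 1 points,
   so, if there is no pair, every colour met after 2rM occurs at most M times
   after rM + 1.  If t colours are met there, at most (t + j - r)M points of the
   window [rM + 2, 2rM] carry one of them; giving these points t + j - r fresh
   colours, each used at most M times, turns the window into a j-coloured
   interval of length rM - 1 >= g(m, j), and the pair found in it cannot use a
   fresh colour.

   Lower bound: number the colours 0, ..., s with s = r - 1, let A be a word of
   length sM in the letters 0, ..., j - 1 without a pair, and let B contain each
   of 0, ..., s - 1 exactly M times, so that a letter occurring k times among the
   first n letters of A occurs at least min(M, k) times among those of B.  The
   word
     s B s^M A j^M (j+1)^M ... s^M
   of length (3r - j - 1)M + 1 has no pair.  Each colour occurs at most M times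
   in the first rM points, so x ends at a position q >= rM, counted from 0; only
   a letter of A can occur more than M times after q, so y ends in A.  If x
   starts at p and its colour occurs in [p, rM], the choice of B forces
   q >= rM + p, so 2q - p >= 2rM is beyond the end of A; otherwise x and y lie
   in A. *)

Set Implicit Arguments.
Unset Strict Implicit.
Unset Printing Implicit Defensive.

Lemma sorted_ltn_cat s1 s2 : sorted ltn (s1 ++ s2) =
  [&& allrel ltn s1 s2, sorted ltn s1 & sorted ltn s2].
Proof. by rewrite !(sorted_pairwise ltn_trans) pairwise_cat. Qed.

Lemma sorted_ltn_head_last s i :
  sorted ltn s -> i \in s -> head 0 s <= i <= last 0 s.
Proof.
move=> sort_s /splitPr si; case: si sort_s => s1 s2.
rewrite sorted_ltn_cat last_cat /= (path_sortedE ltn_trans).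
case/and4P=> /allrelP lt12 _ /allP lt2 _; apply/andP; split.
  case: s1 lt12 => //= k s1 lt12.
  by rewrite ltnW // lt12 ?mem_head // mem_head.
by have := mem_last i s2; rewrite inE => /predU1P[->|/lt2 /ltnW].
Qed.

Lemma mem_head_last (s : seq nat) :
  0 < size s -> head 0 s \in s /\ last 0 s \in s.
Proof. by case: s => // i s _; split; [exact: mem_head | exact: mem_last]. Qed.

Lemma constant_map_eq_in (T : eqType) (D : nat -> T) s i k :
  constant (map D s) -> i \in s -> k \in s -> D i = D k.
Proof.
case: s => // h s /=; rewrite all_map => /allP eq_h.
have {}eq_h l : l \in h :: s -> D l = D h.
  by rewrite inE => /predU1P[-> //|/eq_h/eqP].
by move=> /eq_h -> /eq_h ->.
Qed.

Lemma eq_in_constant_map (T : eqType) (D : nat -> T) s c :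
  {in s, forall i, D i = c} -> constant (map D s).
Proof.
move=> eq_c; apply/(constantP c); exists c.
by apply/all_pred1P/allP => _ /mapP[i /eq_c eq_i ->]; apply/eqP.
Qed.

(** * Pairs and colour counts *)

Definition occ (T : Type) (D : nat -> T) (P : pred T) (a b : nat) : nat :=
  count (preim D P) (index_iota a b).

Section Occ.

Variables (T : Type) (D : nat -> T).
Implicit Types (P : pred T) (a b : nat).

Lemma occ_geq P a b : b <= a -> occ D P a b = 0.
Proof. by rewrite /occ /index_iota -subn_eq0 => /eqP ->. Qed.

Lemma occ_cat P b a c : a <= b <= c -> occ D P a c = occ D P a b + occ D P b c.
Proof.
move=> /andP[ab bc]; rewrite /occ -count_cat /index_iota; congr count.
have -> : c - a = (b - a) + (c - b) by lia.
by rewrite iotaD subnKC.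
Qed.

Lemma occ_recr P a b : a <= b -> occ D P a b.+1 = occ D P a b + P (D b).
Proof.
move=> ab; rewrite (occ_cat P (b := b)) ?ab //=; congr (_ + _).
by rewrite /occ /index_iota subSnn /= addn0.
Qed.

Lemma leq_occ P a b a' b' : a' <= a -> b <= b' -> occ D P a b <= occ D P a' b'.
Proof.
move=> aa bb; case: (leqP b a) => [ba|ab]; first by rewrite occ_geq.
have -> : occ D P a' b' = occ D P a' a + (occ D P a b + occ D P b b').
  by rewrite -!occ_cat //; lia.
lia.
Qed.

Lemma occ_all P a b :
  (forall i, a <= i < b -> P (D i)) -> occ D P a b = b - a.
Proof.
move=> allP_ab; rewrite -[RHS](size_iota a); apply/eqP; rewrite -all_count.
by apply/allP => i; rewrite mem_index_iota => /allP_ab.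
Qed.

Lemma occ_gt0P P a b :
  reflect (exists2 i, a <= i < b & P (D i)) (0 < occ D P a b).
Proof.
rewrite -has_count; apply: (iffP hasP) => -[i iab Pi]; exists i => //.
  by rewrite -mem_index_iota.
by rewrite mem_index_iota.
Qed.

Lemma occ_shift P s a b :
  occ D P (s + a) (s + b) = occ (fun i => D (s + i)) P a b.
Proof. by rewrite /occ /index_iota subnDl iotaDl count_map. Qed.

End Occ.

Lemma occ_sub (T U : Type) (D : nat -> T) (E : nat -> U) (P : pred T)
    (Q : pred U) a b :
  (forall i, a <= i < b -> P (D i) -> Q (E i)) -> occ D P a b <= occ E Q a b.
Proof.
move=> PQ; rewrite /occ -!size_filter; apply: uniq_leq_size.
  exact/filter_uniq/iota_uniq.
by move=> i; rewrite !mem_filter mem_index_iota /= => /andP[Pi iab]; rewrite PQ.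
Qed.

Lemma occ_mem_sum (T : finType) (D : nat -> T) (C : {set T}) a b :
  occ D (mem C) a b = \sum_(c in C) occ D (pred1 c) a b.
Proof.
rewrite /occ; under eq_bigr => c _ do rewrite -sum1_count big_mkcond.
rewrite exchange_big -sum1_count big_mkcond; apply: eq_bigr => i _ /=.
rewrite -big_mkcondr; case: (boolP (D i \in C)) => iC.
  by rewrite (big_pred1 (D i)) // => c; rewrite /= andbC; case: eqVneq => // <-.
rewrite big_pred0 // => c.
by case: eqVneq => [<-|]; rewrite ?(negbTE iC) ?andbF.
Qed.

Lemma occ_nth_cat (T : eqType) (x0 : T) (s1 s2 : seq T) P n : n <= size s2 ->
  occ (nth x0 (s1 ++ s2)) P (size s1) (size s1 + n) = count P (take n s2).
Proof.
move=> ns2; rewrite -{1}(addn0 (size s1)) occ_shift /occ /index_iota subn0.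
rewrite -[in RHS](mkseq_nth x0 s2) -map_take take_iota (minn_idPl ns2).
rewrite count_map.
by apply: eq_count => i /=; rewrite nth_cat ltnNge leq_addr /= addKn.
Qed.

(* The points of x are taken in [p, q] and those of y after q, with y_m >= l;
   then 2 (x_m - x_1) <= y_m - x_1 follows from 2 q <= p + l. *)
Definition doubling_pair (T : eqType) (m : nat) (D : nat -> T) (a b : nat) :
    Prop :=
  exists p q l c, [/\ a <= p <= q, q < l < b, m <= occ D (pred1 c) p q.+1,
    m <= occ D (pred1 (D l)) q.+1 b & 2 * q <= p + l].

Lemma doubling_pair_widen (T : eqType) m (D : nat -> T) a b a' b' :
  a' <= a -> b <= b' -> doubling_pair m D a b -> doubling_pair m D a' b'.
Proof.
move=> aa bb [p [q [l [c [apq qlb mx my pql]]]]].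
exists p, q, l, c; split=> //; [lia | lia |].
by apply: (leq_trans my (leq_occ _ _ _ _)).
Qed.

Lemma doubling_pair_shift (T : eqType) m (D : nat -> T) s a b :
  doubling_pair m D (s + a) (s + b) <->
  doubling_pair m (fun i => D (s + i)) a b.
Proof.
split=> [] [p [q [l [c [apq qlb mx my pql]]]]].
  exists (p - s), (q - s), (l - s), c; split; try lia.
    by rewrite -occ_shift -subSn ?subnKC //; lia.
  by rewrite -(occ_shift D) -subSn ?subnKC //; lia.
exists (s + p), (s + q), (s + l), c; split; try lia.
  by rewrite -addnS occ_shift.
by rewrite -addnS occ_shift.
Qed.

(* A colour class with fewer than m points is invisible to m-point pairs. *)
Lemma doubling_pair_sub (T U : eqType) m (D : nat -> T) (E : nat -> U) a b :
  0 < m ->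
  (forall i k, a <= i < b -> a <= k < b -> E i = E k ->
     m <= occ E (pred1 (E i)) a b -> D i = D k) ->
  doubling_pair m E a b -> doubling_pair m D a b.
Proof.
move=> m0 ED [p [q [l [c [apq qlb mx my pql]]]]].
have /occ_gt0P[i ipq /eqP Ei] := leq_trans m0 mx.
exists p, q, l, (D i); split=> //.
  apply: (leq_trans mx (occ_sub _)) => k kpq /eqP Ek; apply/eqP.
  apply: ED; rewrite ?Ei ?Ek //; [lia | lia |].
  by apply: (leq_trans mx (leq_occ _ _ _ _)); lia.
apply: (leq_trans my (occ_sub _)) => k kqb /eqP Ek; apply/eqP.
apply: ED; rewrite ?Ek //; [lia | lia |].
by apply: (leq_trans my (leq_occ _ _ _ _)); lia.
Qed.

Lemma size_le_occ (T : eqType) (D : nat -> T) s i a b :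
  sorted ltn s -> constant (map D s) -> {in s, forall k, a <= k < b} ->
  i \in s -> size s <= occ D (pred1 (D i)) a b.
Proof.
move=> sort_s const_s s_ab si; rewrite /occ -size_filter.
apply: uniq_leq_size; first exact: (sorted_uniq ltn_trans ltnn sort_s).
move=> k sk; rewrite mem_filter mem_index_iota s_ab // andbT /=.
exact/eqP/constant_map_eq_in/si.
Qed.

Lemma unavoidable_doubling_pair m r N (D : nat -> 'I_r) :
  0 < m -> unavoidable m r N -> doubling_pair m D 1 N.+1.
Proof.
move=> m0 /(_ D)[x [y [[size_x size_y] sort_xy xy_N [const_x const_y] diam]]].
have [hx lx] : head 0 x \in x /\ last 0 x \in x.
  by apply: mem_head_last; rewrite size_x.
have [_ ly] : head 0 y \in y /\ last 0 y \in y.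
  by apply: mem_head_last; rewrite size_y.
move: sort_xy; rewrite sorted_ltn_cat => /and3P[/allrelP lt_xy sort_x sort_y].
have x_ends i := sorted_ltn_head_last (i := i) sort_x.
have [x_N y_N] : {in x, forall i, 1 <= i <= N} /\ {in y, forall i, 1 <= i <= N}.
  by split=> i si; apply: (allP xy_N); rewrite mem_cat si ?orbT.
exists (head 0 x), (last 0 x), (last 0 y), (D (head 0 x)); split.
- by have := x_N _ hx; have := x_ends _ lx; lia.
- by have := lt_xy _ _ lx ly; have := y_N _ ly; lia.
- by rewrite -size_x size_le_occ // => i /x_ends.
- rewrite -size_y size_le_occ // => i yi.
  by have := lt_xy _ _ lx yi; have := y_N _ yi; lia.
- by have := x_ends _ lx; have := lt_xy _ _ lx ly; lia.
Qed.

Lemma last_occurrences (T : eqType) (D : nat -> T) m c a b :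
  0 < m <= occ D (pred1 c) a b -> exists s,
  [/\ size s = m, sorted ltn s, {in s, forall i, a <= i < b /\ D i = c}
    & forall l, a <= l < b -> D l = c -> l <= last 0 s].
Proof.
move=> /andP[m0]; set w := [seq i <- index_iota a b | D i == c].
have -> : occ D (pred1 c) a b = size w by rewrite size_filter.
move=> mw; set s := drop (size w - m) w.
have mem_w i : (i \in w) = (D i == c) && (a <= i < b).
  by rewrite mem_filter mem_index_iota.
have sort_w : sorted ltn w by exact/sorted_filter/iota_ltn_sorted/ltn_trans.
have size_s : size s = m by rewrite size_drop subKn.
exists s; split=> //; first exact: drop_sorted.
  by move=> i /mem_drop; rewrite mem_w => /andP[/eqP].
move=> l lab Dl; have -> : last 0 s = last 0 w.
  rewrite -[in RHS](cat_take_drop (size w - m) w) last_cat -/s.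
  by move: m0; rewrite -size_s; case: (s).
have lw : l \in w by rewrite mem_w Dl eqxx lab.
by have /andP[] := sorted_ltn_head_last sort_w lw.
Qed.

Lemma doubling_pair_unavoidable m r N :
  (forall D : nat -> 'I_r, doubling_pair m D 1 N.+1) -> unavoidable m r N.
Proof.
move=> pair_D D; have [p [q [l [c [pq qlN mx my pql]]]]] := pair_D D.
have [->|m0] := posnP m; first by exists [::], [::].
have [|x [size_x sort_x x_pq _]] := @last_occurrences _ D m c p q.+1.
  by rewrite m0.
have [|y [size_y sort_y y_qN last_y]] :=
    @last_occurrences _ D m (D l) q.+1 N.+1.
  by rewrite m0.
exists x, y; split=> //.
- rewrite sorted_ltn_cat sort_x sort_y !andbT.
  by apply/allrelP => i k /x_pq[ipq _] /y_qN[kqN _]; lia.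
- by apply/allP => i; rewrite mem_cat => /orP[/x_pq[]|/y_qN[]]; lia.
- by split; [apply: (@eq_in_constant_map _ _ _ c) => i /x_pq[] |
    apply: (@eq_in_constant_map _ _ _ (D l)) => i /y_qN[]].
- have [/x_pq[hx _] /x_pq[lx _]] : head 0 x \in x /\ last 0 x \in x.
    by apply: mem_head_last; rewrite size_x.
  by have := last_y l _ erefl; lia.
Qed.

Lemma unavoidable_nat_colouring m j N a (E : nat -> nat) :
  0 < m -> 0 < j -> unavoidable m j N ->
  (forall i, a <= i < a + N -> E i < j) -> doubling_pair m E a (a + N).
Proof.
move=> m0 j0 unav E_lt; pose D i : 'I_j := insubd (Ordinal j0) (E (a + i.-1)).
have /(doubling_pair_shift _ _ 1 0 N) := unavoidable_doubling_pair D m0 unav.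
move=> pair_D; rewrite -{1}(addn0 a); apply/doubling_pair_shift.
apply: doubling_pair_sub pair_D => // i k iN kN /(congr1 val) + _.
by rewrite !val_insubd !E_lt //=; lia.
Qed.

Lemma unavoidable_widen m r N N' :
  N <= N' -> unavoidable m r N -> unavoidable m r N'.
Proof.
move=> NN' unav D; have [x [y [size_xy sort_xy xy_N const_xy diam]]] := unav D.
by exists x, y; split=> //; apply: sub_all xy_N => i; lia.
Qed.

Lemma g_leq_unavoidable m r N : 0 < N -> g m r <= N <-> unavoidable m r N.
Proof.
rewrite /g => N0; case: ex_minnP => n /asboolP[_ unav] min_n; split.
  by move=> /unavoidable_widen; apply.
by move=> unavN; apply: min_n; apply/asboolP.
Qed.

(** * Upper bound *)

Lemma exists_frequent_colour (T : finType) (D : nat -> T) M a b :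
  #|T| * M < b - a -> exists c, M < occ D (pred1 c) a b.
Proof.
move=> many; apply: contrapT => /forallNP rare; move: many; apply/negP.
rewrite -leqNgt -(occ_all (D := D) (P := mem [set: T])) => [|i _]; last first.
  exact: in_setT.
rewrite occ_mem_sum -cardsT -sum_nat_const; apply: leq_sum => c _.
by rewrite leqNgt; apply/negP.
Qed.

Section Recolouring.

Variables (T : finType) (M : nat) (D : nat -> T) (a : nat) (C : {set T}).

Hypothesis M_gt0 : 0 < M.

Let rank i := occ D (mem C) a i.

Lemma occ_rank_block e b :
  occ id [pred i | (D i \in C) && (rank i %/ M == e)] a b <= M.
Proof.
suff -> : occ id [pred i | (D i \in C) && (rank i %/ M == e)] a b =
    minn M (rank b - e * M) by exact: geq_minl.
elim: b => [|b IHb]; first by rewrite /rank !occ_geq ?minn0.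
case: (leqP a b) => [ab|ba]; last by rewrite /rank !occ_geq ?minn0.
rewrite /rank !occ_recr // IHb -/(rank b) /=.
have -> : (rank b %/ M == e) = (e * M <= rank b < e.+1 * M).
  by rewrite eqn_leq -ltnS ltn_divLR // leq_divRL // andbC.
by rewrite mulSn; case: (D b \in C) => /=; lia.
Qed.

(* Colours outside C are renumbered; the points coloured in C are cut, in
   increasing order, into consecutive groups of M, one fresh colour for each. *)
Definition recolour i :=
  if D i \in C then #|~: C| + rank i %/ M else index (D i) (enum (~: C)).

Lemma index_compl_lt c : c \notin C -> index c (enum (~: C)) < #|~: C|.
Proof. by move=> cC; rewrite cardE index_mem mem_enum inE. Qed.

Lemma recolour_lt b s i : occ D (mem C) a b <= s * M -> a <= i < b ->
  recolour i < #|~: C| + s.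
Proof.
move=> few iab; rewrite /recolour.
case: ifP => [iC|/negbT/index_compl_lt]; last lia.
rewrite ltn_add2l ltn_divLR //; apply: leq_trans few.
rewrite (occ_cat _ _ (b := i.+1)) ?occ_recr; try lia.
by rewrite /= iC /rank; lia.
Qed.

Lemma recolour_frequent_inj b i k :
  M < occ recolour (pred1 (recolour i)) a b ->
  recolour i = recolour k -> D i = D k.
Proof.
have fresh l : (D l \in C) = (#|~: C| <= recolour l).
  rewrite /recolour; case: ifP => [_|/negbT/index_compl_lt].
    by rewrite leq_addr.
  by rewrite ltnNge => /negbTE.
move=> freq eq_ik; have /negbTE iC : D i \notin C.
  apply: contraL freq => iC; rewrite -leqNgt.
  apply: leq_trans (occ_rank_block (rank i %/ M) b).
  apply: occ_sub => l _ /eqP eq_li.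
  have lC : D l \in C by rewrite fresh eq_li -fresh.
  by move: eq_li; rewrite /recolour /= lC iC => /addnI ->; rewrite eqxx.
have /negbTE kC : D k \notin C by rewrite fresh -eq_ik -fresh iC.
have memK l : D l \in C = false -> D l \in enum (~: C).
  by move=> lC; rewrite mem_enum inE lC.
move: eq_ik; rewrite /recolour iC kC => eq_ik.
by rewrite -(nth_index (D i) (memK _ iC)) eq_ik nth_index ?memK.
Qed.

End Recolouring.

Lemma doubling_pair_rare_colours (T : finType) j M s (D : nat -> T)
    (C : {set T}) a N :
  0 < M -> 0 < j -> #|~: C| + s <= j -> unavoidable M.+1 j N ->
  occ D (mem C) a (a + N) <= s * M -> doubling_pair M.+1 D a (a + N).
Proof.
move=> M0 j0 Csj unav few.
apply: (doubling_pair_sub (E := recolour M D a C)) => // [i k _ _ eq_ik freq|].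
  exact: recolour_frequent_inj freq eq_ik.
apply: unavoidable_nat_colouring unav _ => // i ia.
exact: leq_trans (recolour_lt M0 few ia) Csj.
Qed.

Lemma unavoidable_add_colours j r M : 0 < j -> j <= r -> 0 < M ->
  unavoidable M.+1 j (r * M).-1 -> unavoidable M.+1 r ((3 * r - j) * M).
Proof.
move=> j0 jr M0 unav; apply: doubling_pair_unavoidable => D.
have -> : (3 * r - j) * M = 2 * (r * M) + (r - j) * M by nia.
set N := 2 * (r * M) + (r - j) * M.
have rM0 : 0 < r * M by rewrite muln_gt0 M0 andbT; lia.
apply: contrapT => no_pair.
have [c freq_c] : exists c, M < occ D (pred1 c) 1 (r * M + 2).
  by apply: exists_frequent_colour; rewrite card_ord; lia.
pose C := [set d | 0 < occ D (pred1 d) (2 * (r * M) + 1) N.+1].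
have rare_C d : d \in C -> occ D (pred1 d) (r * M + 2) N.+1 <= M.
  rewrite inE => /occ_gt0P[l lN /eqP Dl]; rewrite leqNgt; apply/negP => freq_d.
  apply: no_pair; exists 1, (r * M + 1), l, c; rewrite Dl -addnS.
  by split=> //; lia.
have total_C : occ D (mem C) (r * M + 2) N.+1 <= #|C| * M.
  by rewrite occ_mem_sum -sum_nat_const; apply: leq_sum.
have tail_C : occ D (mem C) (2 * (r * M) + 1) N.+1 = (r - j) * M.
  rewrite occ_all => [|i iN]; first by rewrite /N addn1 subSS addKn.
  by suff: D i \in C by []; rewrite inE; apply/occ_gt0P; exists i => /=.
rewrite (occ_cat _ _ (b := 2 * (r * M) + 1)) ?tail_C in total_C; last lia.
have card_C : r - j <= #|C| by rewrite -(leq_pmul2r M0); lia.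
apply: no_pair; apply: (@doubling_pair_widen _ _ _ (r * M + 2)
  (r * M + 2 + (r * M).-1)); [lia | lia |].
apply: (@doubling_pair_rare_colours _ j M (#|C| - (r - j)) _ C) => //.
  by have := cardsC C; rewrite card_ord; lia.
have -> : r * M + 2 + (r * M).-1 = 2 * (r * M) + 1 by lia.
by rewrite mulnBl leq_subRL ?leq_mul2r ?card_C ?orbT // addnC.
Qed.

(** * Lower bound *)

Definition blocks (T : eqType) (M : nat) (e : seq T) : seq T :=
  flatten [seq nseq M d | d <- e].

Section Blocks.

Variables (T : eqType) (M : nat).
Implicit Types (d : T) (e s : seq T).

Lemma size_blocks e : size (blocks M e) = size e * M.
Proof.
by elim: e => //= d e IHe; rewrite size_cat size_nseq -/(blocks M e) IHe mulSn.
Qed.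

Lemma count_blocks e d : uniq e -> count_mem d (blocks M e) = (d \in e) * M.
Proof.
elim: e => //= k e IHe /andP[ke /IHe]; rewrite count_cat count_nseq inE => ->.
by rewrite eq_sym /=; case: eqVneq ke => [->|] //= /negbTE ->; rewrite addn0.
Qed.

Lemma mem_blocks e d : d \in blocks M e -> d \in e.
Proof. by case/flatten_mapP=> k ke /nseqP[->]. Qed.

Lemma first_occurrences s : exists t,
  [/\ subseq t s, forall d, count_mem d t = minn M (count_mem d s)
    & forall q d, minn M (count_mem d (take q s)) <= count_mem d (take q t)].
Proof.
elim/last_ind: s => [|s a [t [sub_ts count_t prefix_t]]].
  by exists [::]; split=> // *; rewrite minn0.
pose t' := if count_mem a s < M then rcons t a else t.
have count_t' d : count_mem d t' = minn M (count_mem d (rcons s a)).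
  rewrite /t' -[in RHS]cats1 count_cat /= addn0.
  by case: ifP => lt_a; rewrite -?cats1 ?count_cat /= count_t;
    case: eqP lt_a => [<-|_] /=; lia.
have sub_t' : subseq t' (rcons s a).
  rewrite /t'; case: ifP => _; rewrite -!cats1.
    exact: cat_subseq.
  exact: subseq_trans (prefix_subseq _ _).
exists t'; split=> // q d.
have [qs|sq] := leqP q (size s).
  rewrite -cats1 takel_cat //; apply: leq_trans (prefix_t q d) _.
  rewrite /t'; case: ifP => // _; rewrite -cats1 take_cat; case: ltnP => // tq.
  by rewrite count_cat take_oversize // leq_addr.
have size_sa : size (rcons s a) <= q by rewrite size_rcons.
by rewrite !take_oversize ?count_t' // (leq_trans (size_subseq sub_t')).
Qed.

Lemma balanced_dominating_word e s : uniq e -> {subset s <= e} ->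
  exists2 t, perm_eq t (blocks M e) & forall q d, q <= size s ->
    minn M (count_mem d (take q s)) <= count_mem d (take q t).
Proof.
move=> uniq_e sub_se.
have [t [_ count_t prefix_t]] := first_occurrences (s ++ blocks M e).
exists t => [|q d qs]; last by rewrite -(takel_cat (blocks M e) qs).
apply/allP => d _; apply/eqP; rewrite count_t count_cat count_blocks //.
case: (boolP (d \in e)) => de; first by rewrite mul1n; lia.
by rewrite (count_memPn (contra (@sub_se d) de)) minn0.
Qed.

End Blocks.

Section AvoidingWord.

(* The colours are 0, ..., s; those of A are 0, ..., j - 1. *)
Variables (j s M : nat) (A B : seq nat).

Hypotheses (M_gt0 : 0 < M) (js : j <= s).
Hypotheses (size_A : size A = s * M) (A_lt : all (ltn^~ j) A).
Hypothesis B_balanced : perm_eq B (blocks M (iota 0 s)).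
Hypothesis B_dominates : forall q d, q <= size A ->
  minn M (count_mem d (take q A)) <= count_mem d (take q B).

Let K := blocks M (iota j (s.+1 - j)).

Definition avoiding_word := s :: B ++ nseq M s ++ A ++ K.

Let D := nth 0 avoiding_word.
Let N := size avoiding_word.
Let R := s.+1 * M.

Lemma size_B : size B = s * M.
Proof. by rewrite (perm_size B_balanced) size_blocks size_iota. Qed.

Lemma size_avoiding_word : N = (3 * s.+1 - j - 1) * M + 1.
Proof.
rewrite /N /= !size_cat size_nseq size_A size_B size_blocks size_iota.
nia.
Qed.

Lemma avoiding_word_lt : all (ltn^~ s.+1) avoiding_word.
Proof.
have blocks_lt a n : a + n <= s.+1 -> all (ltn^~ s.+1) (blocks M (iota a n)).
  by move=> an; apply/allP => d /mem_blocks; rewrite mem_iota /=; lia.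
rewrite /= ltnSn !all_cat (perm_all _ B_balanced) !blocks_lt //; last lia.
rewrite all_nseq /= ltnSn orbT andbT; apply: sub_all A_lt => d /=; lia.
Qed.

Lemma count_B d : count_mem d B = (d < s) * M.
Proof. by rewrite (permP B_balanced) count_blocks ?iota_uniq // mem_iota. Qed.

Lemma count_A_geq d : j <= d -> count_mem d A = 0.
Proof.
by move=> jd; apply/count_memPn/negP => /(allP A_lt)/=; rewrite ltnNge jd.
Qed.

Lemma count_K_le d : count_mem d K <= (j <= d) * M.
Proof.
rewrite count_blocks ?iota_uniq // mem_iota leq_mul2r.
by case: (j <= d); rewrite ?leq_b1 ?orbT.
Qed.

Lemma avoiding_word_cat : avoiding_word = (s :: B ++ nseq M s) ++ A ++ K.
Proof. by rewrite /= -catA. Qed.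

Lemma size_avoiding_prefix : size (s :: B ++ nseq M s) = R.+1.
Proof. by rewrite /= size_cat size_nseq size_B /R mulSn addnC. Qed.

Lemma occ_from_B P n : n < N ->
  occ D P 1 n.+1 = count P (take n (B ++ nseq M s ++ A ++ K)).
Proof. by move=> nN; rewrite -(occ_nth_cat 0 [:: s]). Qed.

Lemma occ_from_A P n : R + n < N ->
  occ D P R.+1 (R.+1 + n) = count P (take n (A ++ K)).
Proof.
rewrite /N avoiding_word_cat size_cat size_avoiding_prefix ltnS leq_add2l.
move=> nAK.
by rewrite /D avoiding_word_cat -size_avoiding_prefix occ_nth_cat.
Qed.

Lemma avoiding_word_R : D R = s.
Proof.
have -> : R = size (s :: B) + M.-1 by rewrite /= size_B /R mulSn; lia.
rewrite /D -[avoiding_word]/((s :: B) ++ _) nth_cat ltnNge leq_addr addKn.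
by rewrite nth_cat size_nseq nth_nseq ltn_predL M_gt0.
Qed.

Lemma size_avoiding_word_split : N = R.+1 + s * M + size K.
Proof.
rewrite /N avoiding_word_cat size_cat size_avoiding_prefix.
by rewrite size_cat size_A addnA.
Qed.

Lemma occ_B_top d : occ D (pred1 d) 1 R.+1 = (d <= s) * M.
Proof.
rewrite occ_from_B ?size_avoiding_word_split; last lia.
rewrite catA take_size_cat; last by have [] := size_avoiding_prefix.
by rewrite count_cat count_B count_nseq /= [d <= s]leq_eqVlt eq_sym; lia.
Qed.

Lemma occ_before_R_le d : occ D (pred1 d) 0 R <= M.
Proof.
have : occ D (pred1 d) 0 R.+1 = occ D (pred1 d) 0 1 + occ D (pred1 d) 1 R.+1.
  exact: occ_cat.
rewrite occ_B_top occ_recr // avoiding_word_R occ_recr //.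
rewrite (occ_geq _ _ (leqnn 0)) add0n addnC => /addnI ->.
by rewrite -[leqRHS]mul1n leq_mul2r leq_b1 orbT.
Qed.

Lemma occ_after_R_le d : j <= d -> occ D (pred1 d) R.+1 N <= M.
Proof.
move=> jd; rewrite size_avoiding_word_split -addnA occ_from_A; last first.
  by rewrite size_avoiding_word_split; lia.
rewrite take_oversize ?size_cat ?size_A // count_cat count_A_geq //.
by apply: leq_trans (count_K_le d) _; rewrite jd mul1n.
Qed.

Lemma occ_dominates d n : n <= s * M ->
  minn M (occ D (pred1 d) R.+1 (R.+1 + n)) <= occ D (pred1 d) 1 n.+1.
Proof.
move=> ns; have RE : R = s * M + M by rewrite /R mulSn addnC.
rewrite occ_from_A ?occ_from_B ?size_avoiding_word_split; try lia.
by rewrite !takel_cat ?size_A ?size_B //; apply: B_dominates; rewrite size_A.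
Qed.

Lemma avoiding_word_after_A_geq i : R + s * M < i < N -> j <= D i.
Proof.
move=> iN; suff /mem_blocks : D i \in K by rewrite mem_iota => /andP[].
have iE : i = R.+1 + (size A + (i - (R.+1 + s * M))) by rewrite size_A; lia.
rewrite /D avoiding_word_cat iE -{1}size_avoiding_prefix nth_cat.
rewrite ltnNge leq_addr addKn nth_cat ltnNge leq_addr addKn mem_nth //.
by have := size_avoiding_word_split; lia.
Qed.

Lemma avoiding_word_A i : i < s * M -> D (R.+1 + i) = nth 0 A i.
Proof.
move=> iA; rewrite /D avoiding_word_cat -size_avoiding_prefix nth_cat.
by rewrite ltnNge leq_addr addKn nth_cat size_A iA.
Qed.

(* The first p - 1 points after the initial s hold fewer points coloured d than
   the first q - R points of A, so domination by B forces p - 1 < q - R. *)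
Lemma crossing_gap d p q : 0 < p -> R <= q <= R + s * M ->
  0 < occ D (pred1 d) p R.+1 -> M < occ D (pred1 d) p q.+1 -> R + p <= q.
Proof.
move=> p0 qR occ_p occ_pq; rewrite leqNgt; apply/negP => q_lt.
have pR : p <= R by case/occ_gt0P: occ_p => i; lia.
have balanced : occ D (pred1 d) 1 p + occ D (pred1 d) p R.+1 <= M.
  rewrite -occ_cat; last lia.
  by rewrite occ_B_top -[leqRHS]mul1n leq_mul2r leq_b1 orbT.
have split_pq : occ D (pred1 d) p q.+1 =
    occ D (pred1 d) p R.+1 + occ D (pred1 d) R.+1 q.+1.
  by rewrite -occ_cat //; lia.
have /(occ_dominates d) : q - R <= s * M by lia.
have -> : R.+1 + (q - R) = q.+1 by lia.
have := @leq_occ _ D (pred1 d) 1 (q - R).+1 1 p (leqnn _).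
lia.
Qed.

Lemma avoiding_word_pair_in_A :
  doubling_pair M.+1 D 0 N -> doubling_pair M.+1 (nth 0 A) 0 (s * M).
Proof.
case=> p [q [l [c [apq qlN occ_x occ_y pql]]]].
have Rq : R <= q.
  rewrite leqNgt; apply: contraL occ_x => qR; rewrite -leqNgt.
  exact: leq_trans (leq_occ _ _ _ _) (occ_before_R_le c).
have Dl_j : D l < j.
  rewrite ltnNge; apply: contraL occ_y => jl; rewrite -leqNgt.
  by apply: leq_trans (leq_occ _ _ _ _) (occ_after_R_le jl).
have lA : l <= R + s * M.
  rewrite leqNgt; apply: contraL Dl_j => ltl; rewrite -leqNgt.
  by apply: avoiding_word_after_A_geq; lia.
have RE : R = s * M + M by rewrite /R mulSn addnC.
have x_after : occ D (pred1 c) p R.+1 = 0.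
  have [//|occ_p] := posnP (occ D (pred1 c) p R.+1).
  have p0 : 0 < p by lia.
  by have := crossing_gap p0 _ occ_p occ_x; lia.
have y_before : occ D (pred1 (D l)) (R.+1 + s * M) N = 0.
  apply/eqP; rewrite -leqn0 leqNgt; apply/negP => /occ_gt0P[i iN /eqP Di].
  by move: Dl_j; rewrite -Di ltnNge avoiding_word_after_A_geq //; lia.
have {}occ_x : M < occ D (pred1 c) (maxn p R.+1) q.+1.
  case: (leqP p R) => pR; last by rewrite (maxn_idPl pR).
  have /maxn_idPr -> : p <= R.+1 by lia.
  by move: occ_x; rewrite (occ_cat _ _ (b := R.+1)) ?x_after //; lia.
apply: (doubling_pair_sub (E := fun i => D (R.+1 + i))) => // [i k iA kA|].
  by rewrite !avoiding_word_A.
apply/doubling_pair_shift; rewrite addn0.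
exists (maxn p R.+1), q, l, c; split=> //; try lia.
  by case/(leq_trans (ltn0Sn _))/occ_gt0P: (occ_x) => i; lia.
move: occ_y; rewrite (occ_cat _ _ (b := R.+1 + s * M)) ?y_before ?addn0 //.
by have := size_avoiding_word_split; lia.
Qed.

Lemma unavoidable_pair_in_A :
  unavoidable M.+1 s.+1 ((3 * s.+1 - j - 1) * M + 1) ->
  doubling_pair M.+1 (nth 0 A) 0 (s * M).
Proof.
rewrite -size_avoiding_word => unav; apply: avoiding_word_pair_in_A.
apply: (unavoidable_nat_colouring (a := 0)) unav _ => // i iN.
exact: (all_nthP 0 avoiding_word_lt).
Qed.

End AvoidingWord.

Lemma avoidable_add_colours j r M : 0 < M -> j < r ->
  ~ unavoidable M.+1 j ((r - 1) * M) ->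
  ~ unavoidable M.+1 r ((3 * r - j - 1) * M + 1).
Proof.
case: r => // s M0; rewrite ltnS subn1 /= => js avoid unav; apply: avoid.
apply: doubling_pair_unavoidable => D.
pose A := [seq val (D i) | i <- iota 1 (s * M)].
have A_lt : all (ltn^~ j) A by apply/allP => _ /mapP[i _ ->]; exact: ltn_ord.
have [|B B_balanced B_dominates] :=
    @balanced_dominating_word _ M (iota 0 s) A (iota_uniq _ _).
  by move=> d /(allP A_lt) dj; rewrite mem_iota (leq_trans dj).
have pair_A : doubling_pair M.+1 (nth 0 A) 0 (s * M).
  by apply: unavoidable_pair_in_A B_balanced B_dominates unav => //;
    rewrite size_map size_iota.
apply/(doubling_pair_shift _ _ 1 0).
apply: doubling_pair_sub pair_A => // i k iA kA.
have nth_A n : 0 <= n < s * M -> nth 0 A n = D (1 + n).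
  by move=> nA; rewrite (nth_map 0) ?nth_iota ?size_iota.
by rewrite !nth_A // => /val_inj.
Qed.

Theorem theorem4p5 (j r m0 : nat) (hj : 0 < j) (hr : 0 < r) (hm0 : 0 < m0)
    (hjr : j < r)
    (hg : forall m : nat, m0 <= m -> 2 <= m ->
       (r - 1) * (m - 1) + 1 <= g m j < r * (m - 1)) :
  forall m : nat, m0 <= m -> 2 <= m ->
    (3 * r - j - 1) * (m - 1) + 1 < g m r <= (3 * r - j) * (m - 1).
Proof.
move=> [//|M] hm M0; have := hg M.+1 hm M0.
rewrite (subn1 M.+1) /= => /andP[lo up].
apply/andP; split.
  have N0 : 0 < (3 * r - j - 1) * M + 1 by rewrite addn1.
  have L0 : 0 < (r - 1) * M by nia.
  rewrite ltnNge; apply/negP => /(g_leq_unavoidable _ _ N0).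
  apply: avoidable_add_colours => //.
  by move=> /(g_leq_unavoidable _ _ L0); lia.
apply/g_leq_unavoidable; first nia.
apply: unavoidable_add_colours => //; first exact: ltnW.
by apply/g_leq_unavoidable; lia.
Qed.
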